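(* Let $\mathbb{K}$ be an infinite field with algebraic closure $\overline{\mathbb{K}}$, and let $n\ge d\ge 1$ be integers. For $V$ generic $n\times d$ Toeplitz with entries in $\mathbb{K}$ and for $\tilde y\in\mathbb{K}^n$, the polynomial system of $d$ equations in the $d$ unknowns $x=(x_1,\dots,x_d)^\top$ given by $$p_\ell(Vx)=p_\ell(\tilde y),\qquad \ell=1,\dots,d,$$ has at most $d!$ roots in $\overline{\mathbb{K}}^d$. That is, there is a dense Zariski-open subset $\mathscr{U}$ of the space of $n\times d$ Toeplitz matrices over $\mathbb{K}$ such that for every $V\in\mathscr{U}$ and every $\tilde y\in\mathbb{K}^n$ the polynomial system $p_\ell(Vx)=p_\ell(\tilde y)$, $\ell=1,\dots,d$, has at most $d!$ roots in $\overline{\mathbb{K}}^d$.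
   Context: For a positive integer $\ell$, $p_\ell(z)=z_1^\ell+\cdots+z_n^\ell$ is the $\ell$-th power-sum polynomial in $n$ variables $z=(z_1,\dots,z_n)$. A matrix is Toeplitz if its $(i,j)$ entry depends only on $i-j$. The space of $n\times d$ Toeplitz matrices with entries in $\mathbb{K}$ is an affine space over $\mathbb{K}$, equipped with the Zariski topology; ''generic Toeplitz'' means belonging to some dense Zariski-open subset of it.
   Formalization: The field K is additionally assumed to have characteristic 0 or greater than d; if 0 < p = char K ≤ d the claim fails, since p_p = (p_1)^p makes an equation redundant and ỹ = 0 gives infinitely many roots for every V. *)

(* Defs.v *)
From mathcomp Require Export all_boot all_order all_algebra.
From mathcomp Require Export mpoly.

Set Implicit Arguments.
Unset Strict Implicit.
Unset Printing Implicit Defensive.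

Import GRing.Theory.
Local Open Scope ring_scope.

Definition infinite_field (K : fieldType) : Prop :=
  forall s : seq K, exists x : K, x \notin s.

(* An algebraic closure of K is an algebraically closed field L together with
   an embedding iota of K into L over which every element of L is algebraic. *)
Definition algebraic_closure (K : fieldType) (L : closedFieldType)
    (iota : {rmorphism K -> L}) : Prop :=
  forall z : L, algebraicOver iota z.

Definition power_sum (R : comNzRingType) (n l : nat) : {mpoly R[n]} :=
  \sum_(i < n) 'X_i ^+ l.

Definition is_toeplitz (R : Type) (n d : nat) (V : 'M[R]_(n, d)) : Prop :=
  forall (i i' : 'I_n) (j j' : 'I_d),
    i%:Z - j%:Z = i'%:Z - j'%:Z -> V i j = V i' j'.

Section Zariski.
Variables (K : fieldType) (n d : nat).
Implicit Types X U W : 'M[K]_(n, d) -> Prop.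

Definition mx_eval (f : {mpoly K[n * d]}) (V : 'M[K]_(n, d)) : K :=
  f.@[fun k => mxvec V 0 k].

(* For a linear subspace X of the space of matrices, the Zariski topology of X
   as an affine space is the one induced by the polynomials in the n * d matrix
   entries, because linear coordinates on X extend to linear forms in the
   entries.  S is an arbitrary, possibly infinite, family of polynomials. *)
Definition zariski_open_in X U : Prop :=
  exists S : {mpoly K[n * d]} -> Prop,
    forall V, U V <-> X V /\ exists2 f, S f & mx_eval f V != 0.

Definition zariski_dense_in X U : Prop :=
  forall W, zariski_open_in X W -> (exists V, W V) -> exists2 V, W V & U V.

End Zariski.

Definition system_root (K : fieldType) (L : fieldType)
    (iota : {rmorphism K -> L}) (n d : nat)
    (V : 'M[K]_(n, d)) (y : 'cV[K]_n) (x : 'cV[L]_d) : Prop :=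
  forall l : nat, (1 <= l <= d)%N ->
    (power_sum L n l).@[fun i => (map_mx iota V *m x) i 0] =
    iota (power_sum K n l).@[fun i => y i 0].

Definition at_most (T : eqType) (N : nat) (P : T -> Prop) : Prop :=
  forall s : seq T, uniq s -> (forall x, x \in s -> P x) -> (size s <= N)%N.

(* Main.v *)
Require Import Defs.
From HB Require Import structures.
From mathcomp Require Import ring zify.
Set Implicit Arguments.
Unset Strict Implicit.
Unset Printing Implicit Defensive.
Import GRing.Theory.
Local Open Scope ring_scope.

(** Let f_l denote the polynomial p_l(Vx) in x_1, ..., x_d.  For most V these d
    forms, of degrees 1, ..., d, have no common zero but the origin, and then the
    Bezout number d! bounds the number of solutions of f_l = c_l whatever the
    constants c_l are.  The proof replaces intersection theory by linear
    algebra, using the d! Artin monomials x_1^a_1 ... x_d^a_d with a_i < i.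

    Call V reducible in degree D ([all_reducible]) when every polynomial g of
    degree at most D is q + sum_l f_l G_l, where q is a combination of Artin
    monomials, deg q <= D and deg G_l <= D - l.

    - At V = [I; 0], which is Toeplitz, f_l is the power sum p_l, and V is
      reducible in every degree ([reducible_power_sums]).  Newton's identities
      put the complete symmetric polynomials of degrees 1, ..., d in the ideal
      of the power sums, because 1, ..., d are invertible in K.  The recurrence
      h_r(x_k+1, ..., x_d) = h_r(x_k, ..., x_d) - x_k h_(r-1)(x_k, ..., x_d)
      then puts h_k(x_k, ..., x_d) there too.  This polynomial has leading term
      x_k^k, so it rewrites any monomial with a_k >= k.

    - Reducibility in a given degree is an open condition: it holds as soon as
      the determinant of a square matrix, polynomial in V and equal to the
      identity at [I; 0], does not vanish ([all_reducible_open]).  A product of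
      finitely many such determinants cuts out the open set, which is dense
      because Toeplitz matrices form a linear space over an infinite field
      ([principal_dense]).

    - If V is reducible in all degrees up to 1 + d(d-1)/2, then on the solutions
      of f_l = c_l every monomial is a combination of Artin monomials: replacing
      f_l by the constant c_l lowers the degree of each f_l G_l, and one more
      variable never takes an Artin monomial beyond that bound
      ([all_roots_agree]).  Interpolation shows that the functions on N distinct
      points span a space of dimension N, hence N <= d!
      ([size_le_spanning]). *)

(** * Complete symmetric polynomials *)

Section CompleteSymmetric.

Variable S : comNzRingType.
Implicit Types (x : S) (s : seq S).

Fixpoint complete_sym s r : S :=
  if s is x :: s' then \sum_(j < r.+1) x ^+ j * complete_sym s' (r - j)%N
  else (r == 0%N)%:R.

#[local] Arguments complete_sym : simpl never.

Lemma complete_sym_cons x s r :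
  complete_sym (x :: s) r = \sum_(j < r.+1) x ^+ j * complete_sym s (r - j)%N.
Proof. by []. Qed.

Lemma complete_sym_cons0 x s : complete_sym (x :: s) 0 = complete_sym s 0.
Proof. by rewrite complete_sym_cons big_ord1 expr0 mul1r. Qed.

(** Adding a variable x multiplies the generating series of the complete
    symmetric polynomials by 1 / (1 - x t). *)
Lemma complete_sym_consS x s r :
  complete_sym (x :: s) r.+1 = complete_sym s r.+1 + x * complete_sym (x :: s) r.
Proof.
rewrite !complete_sym_cons big_ord_recl expr0 mul1r subn0 mulr_sumr.
by congr (_ + _); apply: eq_bigr => j _; rewrite exprS mulrA subSS.
Qed.

Lemma complete_sym0 s : complete_sym s 0 = 1.
Proof. by elim: s => // x s IHs; rewrite complete_sym_cons0. Qed.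

(** Newton's identity, the logarithmic derivative of the generating series
    prod_x 1 / (1 - x t) read coefficientwise.  The induction is on the list of
    variables and then on [r], each time through [complete_sym_consS]. *)
Lemma newton_complete_sym s r :
  r%:R * complete_sym s r =
    \sum_(j < r) (\sum_(x <- s) x ^+ j.+1) * complete_sym s (r - j.+1)%N.
Proof.
elim: s r => [|x s IHs] r.
  rewrite big1 => [|j _]; last by rewrite big_nil mul0r.
  by case: r => [|r]; rewrite ?mul0r // [complete_sym _ _]mulr0n mulr0.
elim: r => [|r IHr]; first by rewrite mul0r big_ord0.
(* The part of the right-hand side that comes from the power sums of [s]; the
   other part, from the powers of [x], is split off the same way below. *)
have step : \sum_(j < r.+1) (\sum_(y <- s) y ^+ j.+1)
                * complete_sym (x :: s) (r.+1 - j.+1)%N =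
    r.+1%:R * complete_sym s r.+1 + x * (\sum_(j < r)
      (\sum_(y <- s) y ^+ j.+1) * complete_sym (x :: s) (r - j.+1)%N).
  rewrite IHs !big_ord_recr /= !subnn [in LHS]complete_sym_cons0.
  rewrite mulr_sumr addrAC -big_split /=; congr (_ + _).
  apply: eq_bigr => j _.
  by rewrite subSn // complete_sym_consS; ring.
under eq_bigr => j _ do rewrite big_cons mulrDl.
rewrite big_split /= step complete_sym_consS.
have -> : \sum_(j < r.+1) x ^+ j.+1 * complete_sym (x :: s) (r.+1 - j.+1)%N =
    x * complete_sym (x :: s) r
    + x * (\sum_(j < r) x ^+ j.+1 * complete_sym (x :: s) (r - j.+1)%N).
  rewrite big_ord_recl expr1 subn1 /=; congr (_ + _).
  rewrite mulr_sumr.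
  by apply: eq_bigr => j _; rewrite exprS mulrA subSS.
have -> : r.+1%:R * (complete_sym s r.+1 + x * complete_sym (x :: s) r) =
   r.+1%:R * complete_sym s r.+1 + x * complete_sym (x :: s) r
   + x * (r%:R * complete_sym (x :: s) r) by rewrite -[r.+1]addn1 natrD; ring.
rewrite IHr; under [in LHS]eq_bigr => j _ do rewrite big_cons mulrDl.
by rewrite big_split /=; ring.
Qed.

End CompleteSymmetric.

(** * Degree bounds *)

Section Measure.

Variables (n : nat) (R : nzRingType).
Implicit Types (mf : measure n) (p q : {mpoly R[n]}).

Lemma mmeasure_leP mf p b :
  reflect (forall m, m \in msupp p -> (mf m < b)%N) (mmeasure mf p <= b)%N.
Proof.
apply: (iffP idP) => [le m mp|le].
  exact: leq_trans (mmeasure_mnm_lt _ mp) le.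
by rewrite mmeasureE big_seq; apply/bigmax_leqP_seq => m mp _; apply: le.
Qed.

(** The asymmetry between the two bounds comes from [mmeasure] being one more than
    the degree of a non-zero polynomial, and zero at zero. *)
Lemma mmeasureM_le mf p q a b :
  (mmeasure mf p <= a.+1)%N -> (mmeasure mf q <= b)%N ->
  (mmeasure mf (p * q) <= a + b)%N.
Proof.
move=> /mmeasure_leP pa /mmeasure_leP qb; apply/mmeasure_leP => m.
move=> /msuppM_le /allpairsP[[m1 m2] /= [/pa m1a /qb m2b ->]].
by rewrite mfD; lia.
Qed.

Lemma mmeasure_sum_le (T : Type) mf (r : seq T) (P : pred T)
    (F : T -> {mpoly R[n]}) b :
  (forall i, P i -> (mmeasure mf (F i) <= b)%N) ->
  (mmeasure mf (\sum_(i <- r | P i) F i) <= b)%N.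
Proof.
move=> Fb; elim/big_ind: _ => [|p q pb qb|//]; first by rewrite mmeasure0.
by apply: leq_trans (mmeasureD_le _ _ _) _; rewrite geq_max pb.
Qed.

Lemma mmeasureX_le mf p k b :
  (mmeasure mf p <= b.+1)%N -> (mmeasure mf (p ^+ k) <= (k * b).+1)%N.
Proof.
move=> pb; elim: k => [|k IHk]; first by rewrite expr0 mmeasure1.
by rewrite exprS mulSn -addnS; apply: mmeasureM_le.
Qed.

End Measure.

(** Stated for an arbitrary additive grading of the monomials, as it serves both
    for the degree and for the grading [coweight] below. *)
Lemma mmeasure_complete_sym (n : nat) (R : comNzRingType) (mf : measure n)
    (b : nat) (s : seq {mpoly R[n]}) (r : nat) :
  (forall x, x \in s -> (mmeasure mf x <= b.+1)%N) ->
  (mmeasure mf (complete_sym s r) <= (r * b).+1)%N.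
Proof.
elim: s r => [|x s IHs] r sb /=.
  case: r => [|r] /=; first by rewrite mmeasure1.
  by rewrite mmeasure0.
apply: mmeasure_sum_le => j _.
have -> : ((r * b).+1 = j * b + ((r - j) * b).+1)%N.
  by rewrite addnS -mulnDl subnKC // -ltnS.
apply: mmeasureM_le; first by apply/mmeasureX_le/sb; rewrite mem_head.
by apply: IHs => y ys; apply: sb; rewrite inE ys orbT.
Qed.

(** * Reduction to Artin monomials *)

Section Reduction.

Variables (K : fieldType) (d : nat).
Implicit Types (f G : 'I_d -> {mpoly K[d]}) (g h : {mpoly K[d]}).

(** Membership in the ideal of the [f l] with control of the degree of the
    cofactors.  Since [l] starts at 0, [f l] stands for a form of degree [l + 1];
    since [msize] is one more than the degree, the bound says that
    [f l * G l] has degree at most [D], and that [G l = 0] when [D <= l]. *)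
Definition ideal_upto f D g : Prop :=
  exists2 G : 'I_d -> {mpoly K[d]},
    forall l : 'I_d, (msize (G l) <= D - l)%N & g = \sum_l f l * G l.

Lemma ideal_upto_le f D E g : (D <= E)%N ->
  ideal_upto f D g -> ideal_upto f E g.
Proof.
move=> DE [G Gle ->]; exists G => // l.
by apply: leq_trans (Gle l) _; apply: leq_sub2r.
Qed.

Lemma ideal_uptoD f D g h :
  ideal_upto f D g -> ideal_upto f D h -> ideal_upto f D (g + h).
Proof.
move=> [G Gle ->] [H Hle ->]; exists (fun l => G l + H l) => [l|].
  by apply: leq_trans (mmeasureD_le _ _ _) _; rewrite geq_max Gle Hle.
by rewrite -big_split; apply: eq_bigr => l _; rewrite mulrDr.
Qed.

Lemma ideal_uptoM f D e g h :
  ideal_upto f D g -> (msize h <= e.+1)%N -> ideal_upto f (e + D) (h * g).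
Proof.
move=> [G Gle ->] he; exists (fun l => h * G l) => [l|].
  have := Gle l; case: (leqP l D) => lD.
    by rewrite -addnBA //; apply: mmeasureM_le.
  have -> : (D - l = 0)%N by apply/eqP; rewrite subn_eq0 ltnW.
  by rewrite leqn0 mmeasure_poly_eq0 => /eqP->; rewrite mulr0 mmeasure0.
by rewrite mulr_sumr; apply: eq_bigr => l _; rewrite mulrCA.
Qed.

(** The Artin monomials, a basis of the coinvariant algebra; the variables being
    numbered from 0, the exponent of the i-th one may be as large as [i]. *)
Definition artin (a : {dffun forall i : 'I_d, 'I_i.+1}) : 'X_{1..d} :=
  [multinom (a i : nat) | i < d].

Definition artin_comb (c : {dffun forall i : 'I_d, 'I_i.+1} -> K)
    : {mpoly K[d]} :=
  \sum_a c a *: 'X_[artin a].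

Definition reducible f D g : Prop :=
  exists2 c, (msize (artin_comb c) <= D.+1)%N & ideal_upto f D (g - artin_comb c).

Lemma artin_combD c c' :
  artin_comb (fun a => c a + c' a) = artin_comb c + artin_comb c'.
Proof. by rewrite -big_split; apply: eq_bigr => a _; rewrite scalerDl. Qed.

Lemma artin_combZ k c : artin_comb (fun a => k * c a) = k *: artin_comb c.
Proof. by rewrite scaler_sumr; apply: eq_bigr => a _; rewrite scalerA. Qed.

Lemma artin_comb0 : artin_comb (fun=> 0) = 0.
Proof. by apply: big1 => a _; rewrite scale0r. Qed.

Lemma reducibleD f D g h :
  reducible f D g -> reducible f D h -> reducible f D (g + h).
Proof.
move=> [c cle gc] [c' c'le hc']; exists (fun a => c a + c' a).
  rewrite artin_combD; apply: leq_trans (mmeasureD_le _ _ _) _.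
  by rewrite geq_max cle.
by rewrite artin_combD opprD addrACA; apply: ideal_uptoD.
Qed.

Lemma ideal_upto_reducible f D g : ideal_upto f D g -> reducible f D g.
Proof.
by exists (fun=> 0); rewrite artin_comb0 ?mmeasure0 // subr0.
Qed.

Lemma ideal_upto0 f D : ideal_upto f D 0.
Proof.
exists (fun=> 0) => [l|]; first by rewrite mmeasure0.
by rewrite big1 // => l _; rewrite mulr0.
Qed.

Lemma reducibleZ f D k g : reducible f D g -> reducible f D (k *: g).
Proof.
move=> [c cle gc]; exists (fun a => k * c a); rewrite artin_combZ.
  exact: leq_trans (mmeasureZ_le _ _ _) cle.
rewrite -scalerBr -mul_mpolyC -[D]add0n; apply: ideal_uptoM => //.
by rewrite mmeasureC; case: eqP.
Qed.

Lemma reducible_sum (T : Type) f D (r : seq T) (P : pred T) F :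
  (forall i, P i -> reducible f D (F i)) ->
  reducible f D (\sum_(i <- r | P i) F i).
Proof.
move=> Fred; elim/big_ind: _ => //; last exact: reducibleD.
exact/ideal_upto_reducible/ideal_upto0.
Qed.

Lemma reducible_artin f D a : (mdeg (artin a) <= D)%N ->
  reducible f D 'X_[artin a].
Proof.
move=> aD; have E : artin_comb (fun b => (b == a)%:R) = 'X_[artin a].
  rewrite /artin_comb (bigD1 a) //= eqxx scale1r big1 ?addr0 // => b /negPf->.
  by rewrite scale0r.
exists (fun b => (b == a)%:R); rewrite E; first by rewrite msizeX.
by rewrite subrr; apply: ideal_upto0.
Qed.

Lemma artinP (m : 'X_{1..d}) :
  (forall i : 'I_d, (m i <= i)%N) -> exists a, m = artin a.
Proof.
move=> mle; exists [ffun i : 'I_d => inord (m i) : 'I_i.+1].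
by apply/mnmP => i; rewrite mnmE ffunE inordK // ltnS.
Qed.

End Reduction.

Section Coweight.

Variable d : nat.

(** A grading for which the earlier variables are heavier: among the monomials
    of degree [k + 1] in the variables of index at least [k], the power of 'X_k
    is the only one of maximal coweight.  Rewriting it by the others
    terminates. *)
Definition coweight (m : 'X_{1..d}) : nat := (\sum_(i < d) m i * (d - i))%N.

Lemma coweight0 : coweight 0 = 0%N.
Proof. by rewrite /coweight big1 // => i _; rewrite mnm0E mul0n. Qed.

Lemma coweightD m1 m2 : coweight (m1 + m2) = (coweight m1 + coweight m2)%N.
Proof.
by rewrite /coweight -big_split; apply: eq_bigr => i _; rewrite mnmDE mulnDl.
Qed.

#[hnf] HB.instance Definition _ := isMeasure.Build d coweight coweight0 coweightD.

Lemma coweight1 i : coweight U_(i) = (d - i)%N.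
Proof.
rewrite /coweight (bigD1 i) //= mnm1E eqxx mul1n big1 ?addn0 // => j ji.
by rewrite mnm1E eq_sym (negPf ji).
Qed.

End Coweight.

Section PowerSums.

Variables (K : fieldType) (d : nat).

Definition vars_from k : seq {mpoly K[d]} := [seq 'X_i | i <- drop k (enum 'I_d)].

Lemma vars_fromS (k : 'I_d) : vars_from k = 'X_k :: vars_from k.+1.
Proof.
by rewrite /vars_from (drop_nth k) ?size_enum_ord //= nth_ord_enum.
Qed.

Lemma mem_vars_from k x : x \in vars_from k ->
  exists2 i : 'I_d, (k <= i)%N & x = 'X_i.
Proof.
case/mapP=> i ik ->; exists i => //; move: ik => /(map_f val).
by rewrite map_drop val_enum_ord drop_iota add0n mem_iota => /andP[].
Qed.

(** From [k = 0] on, each step drops the first variable x from the list and uses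
    that h_r of the shorter list is h_r - x h_(r-1) of the longer one; this costs
    the lowest degree for which membership is known.  At [k = 0] Newton's identity
    can be divided by [r], as a prime divisor of [r] is at most [d]. *)
Lemma complete_sym_ideal :
  (forall p, p \in [pchar K] -> (d < p)%N) -> forall k r,
  (k < r)%N -> (r <= d)%N ->
  ideal_upto (fun l : 'I_d => power_sum K d l.+1) r (complete_sym (vars_from k) r).
Proof.
move=> K_char; elim=> [|k IHk] r kr rd; last first.
  case: r kr rd => // r kr rd; have kd : (k < d)%N by apply: ltn_trans rd.
  have := complete_sym_consS 'X_(Ordinal kd) (vars_from k.+1) r.
  rewrite -(vars_fromS (Ordinal kd)) /= => /esym/(canRL (addrK _))->.
  rewrite -mulNr; apply: ideal_uptoD; first by apply: IHk => //; apply: ltnW.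
  rewrite -[r.+1]add1n; apply: ideal_uptoM; last by rewrite mmeasureN msizeX mdeg1.
  by apply: IHk => //; apply: ltnW.
have r_neq0 : r%:R != 0 :> K.
  apply/negP => r0; have [p pK] := natf0_pchar kr r0.
  have := K_char p pK; have := dvdn_leq kr.
  by move=> /(_ p); rewrite (dvdn_pcharf pK) r0 => /(_ isT); lia.
exists (fun l : 'I_d => if (l < r)%N then
    r%:R^-1 *: complete_sym (vars_from 0) (r - l.+1)%N else 0) => [l|].
  case: ifP => lr; last by rewrite mmeasure0.
  apply: leq_trans (mmeasureZ_le _ _ _) _.
  have -> : (r - l = ((r - l.+1) * 1).+1)%N by rewrite muln1; lia.
  apply: mmeasure_complete_sym => x /mem_vars_from [i _ ->].
  by rewrite msizeX mdeg1.
have := newton_complete_sym (vars_from 0) r.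
have -> : r%:R = r%:R%:MP :> {mpoly K[d]} by rewrite mpolyC_nat.
rewrite mul_mpolyC => /(canRL (scalerK r_neq0)) ->.
rewrite scaler_sumr.
rewrite (big_ord_widen d (fun j => r%:R^-1 *: ((\sum_(x <- vars_from 0) x ^+ j.+1)
  * complete_sym (vars_from 0) (r - j.+1)%N))) //.
rewrite big_mkcond; apply: eq_bigr => l _; case: ifP => _; last by rewrite mulr0.
rewrite scalerAr; congr (_ * _).
by rewrite /vars_from drop0 big_map big_enum.
Qed.

(** The bounds are exclusive, [mmeasure] being one more than the largest value of
    the grading: the remainder has coweight smaller than the [k.+1 * (d - k)] of
    the leading term. *)
Lemma complete_sym_lead (k : 'I_d) (r := complete_sym (vars_from k) k.+1 - 'X_k ^+ k.+1) :
  (msize r <= k.+2)%N /\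
  (mmeasure (coweight (d := d)) r <= k.+1 * (d - k))%N.
Proof.
have -> : r = \sum_(j < k.+1) 'X_k ^+ j * complete_sym (vars_from k.+1) (k.+1 - j)%N.
  rewrite /r vars_fromS complete_sym_cons big_ord_recr /= subnn complete_sym0.
  by rewrite mulr1 addrK.
split; apply: mmeasure_sum_le => j _.
  have -> : k.+2 = (j * 1 + ((k.+1 - j) * 1).+1)%N by have := ltn_ord j; lia.
  apply: mmeasureM_le; first by apply: mmeasureX_le; rewrite msizeX mdeg1.
  apply: mmeasure_complete_sym => x /mem_vars_from [i _ ->].
  by rewrite msizeX mdeg1.
apply: (@leq_trans (j * (d - k) + ((k.+1 - j) * (d - k.+1)).+1)).
  apply: mmeasureM_le.
    by apply: mmeasureX_le; rewrite mmeasureX /= coweight1.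
  apply: mmeasure_complete_sym => x /mem_vars_from [i ki ->].
  by rewrite mmeasureX /= coweight1 ltnS leq_sub2l.
have [jk kd] : (j < k.+1)%N /\ (d - k = (d - k.+1).+1)%N.
  by split=> //; rewrite -subSn.
rewrite kd -[X in (_ <= X * _)%N](subnKC (ltnW jk)) mulnS mulnDl mulnS.
have : (0 < k.+1 - j)%N by rewrite subn_gt0.
move: (d - k.+1)%N (k.+1 - j)%N => e q; nia.
Qed.

(** A monomial that is not an Artin monomial has a factor 'X_k ^+ k.+1, which is
    congruent to minus the remainder of [complete_sym_lead]: the coweight drops
    and the degree does not grow. *)
Lemma reducible_power_sums : (forall p, p \in [pchar K] -> (d < p)%N) ->
  forall D g, (msize g <= D.+1)%N ->
  reducible (fun l : 'I_d => power_sum K d l.+1) D g.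
Proof.
move=> K_char D g gD; set f := fun l => _.
have [M] := ubnP (mmeasure (coweight (d := d)) g); elim: M => // M IHM in g gD *.
rewrite ltnS => gM; rewrite [g]mpolyE big_seq; apply: reducible_sum => m mg.
apply: reducibleZ; have mD : (mdeg m <= D)%N.
  by have := leq_trans (msize_mdeg_lt mg) gD.
have mM : (coweight m < M)%N by have := leq_trans (mmeasure_mnm_lt _ mg) gM.
have [/forallP/artinP[a ma]|/forallPn[k]] := boolP [forall i : 'I_d, (m i <= i)%N].
  by rewrite ma; apply: reducible_artin; rewrite -ma.
rewrite -ltnNge => km; pose m' := (m - U_(k) *+ k.+1)%MM.
have mE : m = (m' + U_(k) *+ k.+1)%MM.
  rewrite /m' submK //; apply/mnm_lepP => i; rewrite mulmnE mnm1E.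
  by case: eqP => [<-|_]; rewrite ?mul1n.
pose h := complete_sym (vars_from k) k.+1.
have -> : 'X_[m] = 'X_[m'] * h + (- 1) *: ('X_[m'] * (h - 'X_k ^+ k.+1)) :> {mpoly K[d]}.
  by rewrite mE mpolyXD -mpolyXn scaleN1r; ring.
have mdegE : mdeg m = (mdeg m' + k.+1)%N by rewrite mE mdegD mdegMn mdeg1 mul1n.
have cwE : coweight m = (coweight m' + k.+1 * (d - k))%N.
  rewrite mE coweightD; congr (_ + _)%N; elim: k.+1 => [|e IHe].
    by rewrite mulm0n coweight0.
  by rewrite mulmS coweightD IHe coweight1.
have [rdeg rcw] := complete_sym_lead k.
apply: reducibleD.
  apply/ideal_upto_reducible/(@ideal_upto_le _ _ _ (mdeg m' + k.+1)); first by rewrite -mdegE.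
  apply: ideal_uptoM; last by rewrite msizeX.
  exact: complete_sym_ideal.
apply/reducibleZ/IHM.
  apply: leq_trans (_ : (mdeg m' + k.+2 <= _)%N); last by rewrite addnS -mdegE.
  by apply: mmeasureM_le rdeg; rewrite msizeX.
apply: leq_ltn_trans mM; rewrite cwE; apply: mmeasureM_le rcw.
by rewrite mmeasureX.
Qed.

End PowerSums.

(** * Openness of reducibility *)

Section PolynomialFunctions.

Variables (K : fieldType) (n d : nat).
Implicit Types (F G : 'M[K]_(n, d) -> K).

Definition polyfun F : Prop :=
  exists f : {mpoly K[n * d]}, forall V, F V = mx_eval f V.

Lemma eq_polyfun F G : F =1 G -> polyfun F -> polyfun G.
Proof. by move=> FG [f fE]; exists f => V; rewrite -FG fE. Qed.

Lemma polyfun_cst c : polyfun (fun=> c).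
Proof. by exists c%:MP => V; rewrite /mx_eval mevalC. Qed.

Lemma polyfun_entry i j : polyfun (fun V => V i j).
Proof.
by exists 'X_(mxvec_index i j) => V; rewrite /mx_eval mevalXU mxvecE.
Qed.

Lemma polyfunD F G : polyfun F -> polyfun G -> polyfun (fun V => F V + G V).
Proof.
by move=> [f Ff] [g Gg]; exists (f + g) => V; rewrite Ff Gg /mx_eval mevalD.
Qed.

Lemma polyfunM F G : polyfun F -> polyfun G -> polyfun (fun V => F V * G V).
Proof.
by move=> [f Ff] [g Gg]; exists (f * g) => V; rewrite Ff Gg /mx_eval mevalM.
Qed.

Lemma polyfun_sum (I : Type) (r : seq I) (P : pred I) (F : I -> 'M[K]_(n, d) -> K) :
  (forall i, polyfun (F i)) -> polyfun (fun V => \sum_(i <- r | P i) F i V).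
Proof.
move=> Fpoly; elim: r => [|i r [g gE]].
  by exists 0 => V; rewrite big_nil /mx_eval meval0.
have [f fE] := Fpoly i; exists (if P i then f + g else g) => V.
by rewrite big_cons; case: ifP => _; rewrite gE // fE /mx_eval mevalD.
Qed.

Lemma polyfun_prod (I : Type) (r : seq I) (P : pred I) (F : I -> 'M[K]_(n, d) -> K) :
  (forall i, polyfun (F i)) -> polyfun (fun V => \prod_(i <- r | P i) F i V).
Proof.
move=> Fpoly; elim: r => [|i r [g gE]].
  by exists 1 => V; rewrite big_nil /mx_eval meval1.
have [f fE] := Fpoly i; exists (if P i then f * g else g) => V.
by rewrite big_cons; case: ifP => _; rewrite gE // fE /mx_eval mevalM.
Qed.

Lemma polyfun_det N (M : 'M[K]_(n, d) -> 'M[K]_N) :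
  (forall i j, polyfun (fun V => M V i j)) -> polyfun (fun V => \det (M V)).
Proof.
move=> Mpoly; apply: polyfun_sum => s; apply: polyfunM; first exact: polyfun_cst.
by apply: polyfun_prod => i; apply: Mpoly.
Qed.

Definition coef_polyfun k (F : 'M[K]_(n, d) -> {mpoly K[k]}) : Prop :=
  forall m, polyfun (fun V => (F V)@_m).

Section Coef.
Variable k : nat.
Implicit Types P Q : 'M[K]_(n, d) -> {mpoly K[k]}.

Lemma coef_polyfun_cst p : coef_polyfun (fun=> p : {mpoly K[k]}).
Proof. by move=> m; apply: polyfun_cst. Qed.

Lemma coef_polyfunD P Q :
  coef_polyfun P -> coef_polyfun Q -> coef_polyfun (fun V => P V + Q V).
Proof.
move=> Pp Qp m; have := polyfunD (Pp m) (Qp m).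
by apply: eq_polyfun => V; rewrite mcoeffD.
Qed.

Lemma coef_polyfunM P Q :
  coef_polyfun P -> coef_polyfun Q -> coef_polyfun (fun V => P V * Q V).
Proof.
move=> Pp Qp m.
apply: (eq_polyfun (fun V => esym (mcoeffM (P V) (Q V) m))).
by apply: polyfun_sum => ij; apply: polyfunM.
Qed.

Lemma coef_polyfunX P l : coef_polyfun P -> coef_polyfun (fun V => P V ^+ l).
Proof.
move=> Pp; elim: l => [|l IHl]; first exact: coef_polyfun_cst.
move=> m; apply: eq_polyfun (coef_polyfunM Pp IHl m) => V.
by rewrite exprS.
Qed.

Lemma coef_polyfun_sum (I : Type) (r : seq I) (P : I -> 'M[K]_(n, d) -> {mpoly K[k]}) :
  (forall i, coef_polyfun (P i)) -> coef_polyfun (fun V => \sum_(i <- r) P i V).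
Proof.
move=> Pp m; apply: eq_polyfun (polyfun_sum r predT (fun i => Pp i m)) => V.
by rewrite raddf_sum.
Qed.

End Coef.

End PolynomialFunctions.

Section Pullback.

Variables (K : fieldType) (n d : nat).
Implicit Types V : 'M[K]_(n, d).

Definition pullback V l : {mpoly K[d]} :=
  \sum_(i < n) (\sum_(j < d) V i j *: 'X_j) ^+ l.

Definition pullbacks V (l : 'I_d) := pullback V l.+1.

Lemma pullback_pid l : (d <= n)%N -> (0 < l)%N ->
  pullback (pid_mx d) l = power_sum K d l.
Proof.
move=> dn l_gt0; rewrite /pullback (bigID (fun i : 'I_n => i < d)%N) /=.
rewrite addrC big1 => [|i id]; last first.
  rewrite big1 ?expr0n ?gtn_eqF // => j _.
  by rewrite mxE (negPf id) andbF scale0r.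
rewrite add0r (big_ord_narrow dn); apply: eq_bigr => i _.
rewrite (bigD1 i) //= mxE /= eqxx ltn_ord scale1r big1 ?addr0 // => j ji.
by rewrite mxE /= eq_sym [_ == _](negPf ji) scale0r.
Qed.

Lemma coef_polyfun_pullback l : coef_polyfun (fun V => pullback V l).
Proof.
apply: coef_polyfun_sum => i; apply: coef_polyfunX; apply: coef_polyfun_sum => j m.
have := polyfunM (polyfun_entry K i j) (polyfun_cst n d ('X_j : {mpoly K[d]})@_m).
by apply: eq_polyfun => V; rewrite mcoeffZ.
Qed.

Lemma msize_pullback V l : (msize (pullback V l) <= l.+1)%N.
Proof.
apply: mmeasure_sum_le => i _; rewrite -[l in l.+1]muln1; apply: mmeasureX_le.
apply: mmeasure_sum_le => j _; apply: leq_trans (mmeasureZ_le _ _ _) _.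
by rewrite msizeX mdeg1.
Qed.

Definition all_reducible V D :=
  forall g, (msize g <= D.+1)%N -> reducible (pullbacks V) D g.

(** Choose, for each monomial m of degree at most [D], an expression
    m = q_m + sum_l f_l G_(m,l) at [V0], and keep q_m and G_(m,l) while [V]
    varies.  The polynomials h_m(V) = q_m + sum_l f_l G_(m,l) so obtained are
    reducible by construction and of degree at most [D].  They span everything
    as soon as the matrix of their coefficients, which is the identity at [V0],
    is invertible. *)
Lemma all_reducible_open V0 D : all_reducible V0 D ->
  exists2 f : {mpoly K[n * d]}, mx_eval f V0 != 0 &
    forall V, mx_eval f V != 0 -> all_reducible V D.
Proof.
move=> red0; pose I : finType := 'X_{1..d < D.+1}.
have /fin_all_exists[c /fin_all_exists2[G Gle GE]] (m : I) :
    exists c, exists2 G : 'I_d -> {mpoly K[d]},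
    (msize (artin_comb c) <= D.+1)%N /\ (forall l : 'I_d, (msize (G l) <= D - l)%N)
    & 'X_[m] = artin_comb c + \sum_l pullbacks V0 l * G l.
  have [|c cle [G Gle /(canRL (subrK _)) GE]] := red0 'X_[m].
    by rewrite msizeX bmdeg.
  by exists c, G; rewrite // addrC.
have [ev [rk rkK ev_inj]] : exists ev : 'I_#|I| -> I,
    exists2 rk, cancel rk ev & injective ev.
  by exists enum_val, enum_rank; [exact: enum_rankK | exact: enum_val_inj].
pose h V (m : I) := artin_comb (c m) + \sum_l pullbacks V l * G m l.
pose N V := \matrix_(i, j < #|I|) (h V (ev i))@_(ev j : I).
have hsize V m : (msize (h V m) <= D.+1)%N.
  apply: leq_trans (mmeasureD_le _ _ _) _; rewrite geq_max (Gle m).1.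
  apply: mmeasure_sum_le => l _; have := (Gle m).2 l; have [lD Gl|Dl] := ltnP l D.
    have -> : D.+1 = (l.+1 + (D - l))%N by rewrite addSn subnKC // ltnW.
    exact: mmeasureM_le (msize_pullback V _) Gl.
  have -> : (D - l = 0)%N by apply/eqP; rewrite subn_eq0.
  by rewrite leqn0 mmeasure_poly_eq0 => /eqP->; rewrite mulr0 mmeasure0.
have N0 : N V0 = 1%:M.
  apply/matrixP => i j; rewrite !mxE /h -GE mcoeffX.
  by rewrite (inj_eq val_inj) (inj_eq ev_inj).
have [f fE] : polyfun (fun V => \det (N V)).
  apply: polyfun_det => i j; set m := ev i; set m' := ev j.
  apply: (@eq_polyfun _ _ _ (fun V => (h V m)@_(m' : I))) => [V|]; first by rewrite mxE.
  apply: coef_polyfunD; first exact: coef_polyfun_cst.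
  apply: coef_polyfun_sum => l; apply: coef_polyfunM; last exact: coef_polyfun_cst.
  exact: coef_polyfun_pullback.
exists f => [|V]; first by rewrite -fE N0 det1 oner_neq0.
rewrite -fE -unitfE -unitmxE => Nunit g gD.
pose b := (\row_j g@_(ev j : I)) *m invmx (N V).
have gE : g = \sum_i b 0 i *: h V (ev i).
  have bN : b *m N V = \row_j g@_(ev j : I) by rewrite mulmxKV.
  have gcoef (m : I) : g@_m = \sum_i b 0 i * (h V (ev i))@_m.
    rewrite -(rkK m); have /rowP/(_ (rk m)) := bN; rewrite !mxE => <-.
    by apply: eq_bigr => i _; congr (_ * _); rewrite mxE.
  apply/mpolyP => m; rewrite raddf_sum /=; have [mD|Dm] := ltnP (mdeg m) D.+1.
    rewrite (gcoef (BMultinom mD)); apply: eq_bigr => i _.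
    by rewrite mcoeffZ.
  rewrite memN_msupp_eq0 ?msize_mdeg_ge ?(leq_trans gD) // big1 // => i _.
  rewrite mcoeffZ [X in _ * X]memN_msupp_eq0 ?mulr0 //.
  by rewrite msize_mdeg_ge // (leq_trans (hsize _ _)).
rewrite gE; apply: reducible_sum => i _; apply: reducibleZ.
exists (c (ev i)); first exact: (Gle _).1.
by exists (G (ev i)); [exact: (Gle _).2 | rewrite /h addrC addKr].
Qed.

Lemma all_reducible_upto_open V0 N : (forall D, all_reducible V0 D) ->
  exists2 f : {mpoly K[n * d]}, mx_eval f V0 != 0 &
    forall V, mx_eval f V != 0 -> forall D, (D <= N)%N -> all_reducible V D.
Proof.
move=> red0; elim: N => [|N [f f0 fred]].
  have [f f0 fred] := all_reducible_open (red0 0%N); exists f => // V /fred fV D.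
  by rewrite leqn0 => /eqP->.
have [h h0 hred] := all_reducible_open (red0 N.+1).
exists (f * h) => [|V]; first by rewrite /mx_eval mevalM mulf_neq0.
rewrite /mx_eval mevalM mulf_eq0 negb_or => /andP[/fred fV /hred hV] D.
by rewrite leq_eqVlt => /orP[/eqP->//|]; apply: fV.
Qed.

End Pullback.

(** * From reducibility to the number of roots *)

Section Counting.

Variables (L : fieldType) (d : nat).

(** A Lagrange interpolation polynomial: a product of affine coordinate functions,
    one for each point of [s] to be avoided. *)
Lemma point_separator (s : seq 'cV[L]_d) (x : 'cV[L]_d) : exists p : {mpoly L[d]},
  p.@[fun i => x i 0] = 1 /\
  forall y, y \in s -> y != x -> p.@[fun i => y i 0] = 0.
Proof.
elim: s => [|z s [p [px ps]]]; first by exists 1; rewrite meval1.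
have [->|zx] := eqVneq z x.
  by exists p; split=> // y; rewrite inE => /predU1P[->|/ps//]; rewrite eqxx.
have [i zxi] : exists i, z i 0 != x i 0.
  apply/existsP; apply: contraNT zx; rewrite negb_exists => /forallP zx.
  by apply/eqP/colP => i; apply/eqP; have := zx i; rewrite negbK.
exists (p * ((x i 0 - z i 0)^-1 *: ('X_i - (z i 0)%:MP))); split.
  rewrite mevalM px mevalZ mevalB mevalXU mevalC mul1r mulVf //.
  by rewrite subr_eq0 eq_sym.
move=> y; rewrite inE mevalM => /predU1P[-> _|/ps py /py->]; last by rewrite mul0r.
by rewrite mevalZ mevalB mevalXU mevalC subrr !mulr0.
Qed.

(** Interpolation factors the identity matrix of size [size s] through a space of
    dimension #|A|. *)
Lemma size_le_spanning (A : finType) (e : A -> 'X_{1..d}) (s : seq 'cV[L]_d) :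
  uniq s ->
  (forall m : 'X_{1..d}, exists b : A -> L, forall x, x \in s ->
     'X_[m].@[fun i => x i 0] = \sum_a b a * 'X_[e a].@[fun i => x i 0]) ->
  (size s <= #|A|)%N.
Proof.
move=> s_uniq span.
have spanp (p : {mpoly L[d]}) : exists b : A -> L, forall x, x \in s ->
    p.@[fun i => x i 0] = \sum_a b a * 'X_[e a].@[fun i => x i 0].
  elim/mpolyind: p => [|c m p _ _ [b bE]].
    exists (fun=> 0) => x _; rewrite meval0 big1 // => a _; exact: mul0r.
  have [b' b'E] := span m; exists (fun a => c * b' a + b a) => x xs.
  rewrite mevalD mevalZ bE // b'E // mulr_sumr -big_split.
  by apply: eq_bigr => a _; rewrite mulrDl mulrA.
pose x (i : 'I_(size s)) := tnth (in_tuple s) i.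
have x_inj : injective x by apply/(@tuple_uniqP _ _ (in_tuple s)).
have /fin_all_exists[b bE] (j : 'I_(size s)) : exists b : A -> L,
    forall i, \sum_a b a * 'X_[e a].@[fun k => x i k 0] = (i == j)%:R.
  have [p [px ps]] := point_separator s (x j); have [b bE] := spanp p.
  exists b => i; rewrite -bE ?mem_tnth //; have [->//|ij] := eqVneq i j.
  by apply: ps; [exact: mem_tnth | rewrite (inj_eq x_inj)].
pose E := \matrix_(i < size s, a < #|A|) 'X_[e (enum_val a)].@[fun k => x i k 0].
pose B := \matrix_(a < #|A|, j < size s) b j (enum_val a).
apply: (@mulmx1_min _ _ _ E B); apply/matrixP => i j; rewrite !mxE -bE.
rewrite [RHS](reindex _ (onW_bij _ (enum_val_bij A))).
by apply: eq_bigr => a _; rewrite !mxE mulrC.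
Qed.

End Counting.

Lemma card_artin d : #|{dffun forall i : 'I_d, 'I_i.+1}| = d`!.
Proof.
rewrite card_dep_ffun fact_prod big_add1 big_mkord foldrE big_map big_enum.
by apply: eq_bigr => i _; rewrite card_ord.
Qed.

Section Roots.

Variables (K L : fieldType) (iota : {rmorphism K -> L}) (n d : nat).
Variables (V : 'M[K]_(n, d)) (y : 'cV[K]_n).

Local Notation eval_at x := (mmap iota (fun i => x i 0)).

Lemma eval_at_pullback (x : 'cV[L]_d) l :
  eval_at x (pullback V l) = (power_sum L n l).@[fun i => (map_mx iota V *m x) i 0].
Proof.
rewrite !raddf_sum; apply: eq_bigr => i _; rewrite /= !rmorphXn /= mevalXU.
congr (_ ^+ l); rewrite raddf_sum mxE; apply: eq_bigr => j _.
by rewrite /= mmapZ mmapX mmap1U mxE.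
Qed.

(** Congruence to a combination of Artin monomials on the solution set, with
    coefficients in the base field that do not depend on the solution. *)
Definition roots_agree g := exists c, forall x,
  system_root iota V y x -> eval_at x g = eval_at x (artin_comb c).

Lemma roots_agree_lin k g h :
  roots_agree g -> roots_agree h -> roots_agree (k *: g + h).
Proof.
move=> [c cE] [c' c'E]; exists (fun a => k * c a + c' a) => x xroot.
by rewrite artin_combD artin_combZ !mmapD !mmapZ cE // c'E.
Qed.

Lemma roots_agree0 : roots_agree 0.
Proof. by exists (fun=> 0) => x _; rewrite artin_comb0. Qed.

Lemma roots_agree_sum (I : Type) (r : seq I) k g :
  (forall i, roots_agree (g i)) -> roots_agree (\sum_(i <- r) k i *: g i).
Proof.
move=> gP; elim: r => [|i r IHr]; first by rewrite big_nil; apply: roots_agree0.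
by rewrite big_cons; apply: roots_agree_lin.
Qed.

(** On the solutions, each term [f l * G l] of a reduction of [g] becomes a
    constant times [G l], of degree smaller than [D]. *)
Lemma reducible_roots_agree D g :
  (forall E, (E <= D)%N -> all_reducible V E) ->
  (msize g <= D.+1)%N -> roots_agree g.
Proof.
elim/ltn_ind: D g => D IHD g red gD.
have [c cD [G Gle /(canRL (subrK _)) gE]] := red D (leqnn _) g gD.
pose r (l : 'I_d) := (power_sum K n l.+1).@[fun i => y i 0].
have cP : roots_agree (artin_comb c) by exists c.
have GP l : roots_agree (G l).
  have [lD|Dl] := ltnP l D.
    apply: (IHD (D - l.+1)%N) => [|E ED|]; first by rewrite -subSn // subSS leq_subr.
      by apply: red; apply: leq_trans ED (leq_subr _ _).
    by rewrite -subSn // subSS Gle.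
  have := Gle l; have -> : (D - l = 0)%N by apply/eqP; rewrite subn_eq0.
  by rewrite leqn0 mmeasure_poly_eq0 => /eqP->; apply: roots_agree0.
have [c' c'E] : roots_agree (1 *: artin_comb c + \sum_l r l *: G l).
  by apply: roots_agree_lin => //; apply: roots_agree_sum.
exists c' => x xroot; rewrite -c'E // scale1r gE addrC !mmapD !raddf_sum.
congr (_ + _); apply: eq_bigr => l _.
rewrite /= mmapZ rmorphM /=; congr (_ * _).
by rewrite /pullbacks eval_at_pullback xroot // ltn_ord.
Qed.

Lemma mdeg_artin (a : {dffun forall i : 'I_d, 'I_i.+1}) :
  (mdeg (artin a) <= \sum_(i < d) i)%N.
Proof.
by rewrite mdegE; apply: leq_sum => i _; rewrite mnmE -ltnS.
Qed.

(** By induction on the degree of [m]: once [m - U_(i)] has been replaced by Artin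
    monomials, of degree at most 0 + 1 + ... + (d-1), multiplying by 'X_i gives
    monomials in the range of degrees where [V] is reducible. *)
Lemma all_roots_agree :
  (forall D, (D <= (\sum_(i < d) i).+1)%N -> all_reducible V D) ->
  forall m, roots_agree 'X_[m].
Proof.
move=> red m; have [k] := ubnP (mdeg m); elim: k => // k IHk in m *.
have [->|m_neq0] := eqVneq m 0%MM.
  by move=> _; apply: reducible_roots_agree red _; rewrite msizeX mdeg0.
have [i mi] : exists i, m i != 0%N.
  apply/existsP; apply: contraNT m_neq0; rewrite negb_exists => /forallP m0.
  by apply/eqP/mnmP => i; have := m0 i; rewrite negbK mnm0E => /eqP.
have mE : m = (U_(i) + (m - U_(i)))%MM by rewrite addmC submK // lep1mP.
rewrite mE mdegD mdeg1 add1n ltnS => /IHk[c cE].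
have : roots_agree (\sum_a c a *: ('X_i * 'X_[artin a])).
  apply: roots_agree_sum => a; apply: reducible_roots_agree red _.
  by rewrite -mpolyXD msizeX mdegD mdeg1 add1n !ltnS mdeg_artin.
case=> c' c'E; exists c' => x xroot; rewrite -c'E // mpolyXD rmorphM /= cE //.
rewrite -rmorphM /artin_comb mulr_sumr; congr (eval_at x _).
by apply: eq_bigr => a _; rewrite scalerAr.
Qed.

Lemma at_most_roots :
  (forall D, (D <= (\sum_(i < d) i).+1)%N -> all_reducible V D) ->
  at_most d`! (system_root iota V y).
Proof.
move=> red s s_uniq sroot; rewrite -card_artin.
apply: (@size_le_spanning _ _ _ (@artin d)) s_uniq _ => m.
have [c cE] := all_roots_agree red m; exists (fun a => iota (c a)) => x xs.
have := cE x (sroot x xs).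
rewrite raddf_sum /= !mmapX /mmap1 mevalX => ->.
by apply: eq_bigr => a _; rewrite mmapZ mmapX mevalX.
Qed.

End Roots.

(** * Density *)

Section Density.

Variables (K : fieldType) (n d : nat).

Lemma nonroot (p : {poly K}) : infinite_field K -> p != 0 -> exists t, p.[t] != 0.
Proof.
move=> K_infinite p_neq0.
have [s s_uniq ssize] : exists2 s : seq K, uniq s & size s = size p.
  elim: (size p) => [|k [s s_uniq <-]]; first by exists [::].
  by have [x xs] := K_infinite s; exists (x :: s); rewrite //= xs.
have /allPn[t _ tp] : ~~ all (root p) s.
  by apply/negP => sp; have := max_poly_roots p_neq0 sp s_uniq; rewrite ssize ltnn.
by exists t.
Qed.

Lemma mx_eval_line (f : {mpoly K[n * d]}) (A B : 'M[K]_(n, d)) :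
  exists p : {poly K}, forall t, p.[t] = mx_eval f (A + t *: B).
Proof.
exists (mmap polyC (fun k => (mxvec A 0 k)%:P + 'X * (mxvec B 0 k)%:P) f) => t.
rewrite /mx_eval /meval /mmap -horner_evalE rmorph_sum.
apply: eq_bigr => m _; rewrite rmorphM /= horner_evalE hornerC; congr (_ * _).
rewrite rmorph_prod; apply: eq_bigr => k _.
by rewrite rmorphXn /= horner_evalE !hornerE linearD linearZ /= !mxE.
Qed.

(** Two non-empty open subsets meet on the line through a point of each: there
    their equations are two non-zero polynomials in one variable, whose product
    has a non-root in the infinite field. *)
Lemma principal_dense (X : 'M[K]_(n, d) -> Prop) (f : {mpoly K[n * d]}) V0 :
  infinite_field K -> (forall A B t, X A -> X B -> X (A + t *: (B - A))) ->
  X V0 -> mx_eval f V0 != 0 ->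
  zariski_dense_in X (fun V => X V /\ mx_eval f V != 0).
Proof.
move=> K_infinite X_affine XV0 fV0 W [S WE] [V1 /WE[XV1 [g Sg gV1]]].
have [p pE] := mx_eval_line f V0 (V1 - V0).
have [q qE] := mx_eval_line g V0 (V1 - V0).
have p_neq0 : p != 0.
  apply: contraNneq fV0 => p0.
  by rewrite -[V0]addr0 -(scale0r (V1 - V0)) -pE p0 horner0.
have q_neq0 : q != 0.
  apply: contraNneq gV1 => q0.
  by rewrite -[V1](subrKC V0) -[V1 - V0]scale1r -qE q0 horner0.
have [t] := nonroot K_infinite (mulf_neq0 p_neq0 q_neq0).
rewrite hornerM mulf_eq0 negb_or pE qE => /andP[ft gt].
have Xt : X (V0 + t *: (V1 - V0)) by apply: X_affine.
exists (V0 + t *: (V1 - V0)) => //; apply/WE; split=> //.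
by exists g.
Qed.

End Density.

Lemma toeplitz_pid (K : fieldType) n d : is_toeplitz (pid_mx d : 'M[K]_(n, d)).
Proof.
move=> i i' j j' /eqP ij; rewrite !mxE.
suff -> : (i == j :> nat) && (i < d)%N = (i' == j' :> nat) && (i' < d)%N by [].
have E (k : 'I_n) (l : 'I_d) : (k == l :> nat) && (k < d)%N = (k%:Z - l%:Z == 0).
  by rewrite subr_eq0 eqz_nat; case: eqP => // ->; rewrite ltn_ord.
by rewrite !E (eqP ij).
Qed.

Lemma toeplitz_affine (K : fieldType) n d (A B : 'M[K]_(n, d)) t :
  is_toeplitz A -> is_toeplitz B -> is_toeplitz (A + t *: (B - A)).
Proof.
by move=> At Bt i i' j j' ij; rewrite !mxE (At _ _ _ _ ij) (Bt _ _ _ _ ij).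
Qed.

Theorem theorem7 (K : fieldType) (L : closedFieldType)
    (iota : {rmorphism K -> L}) (n d : nat)
    (K_infinite : infinite_field K)
    (L_closure : algebraic_closure iota)
    (d_gt0 : (1 <= d)%N) (d_le_n : (d <= n)%N)
    (K_char : forall p : nat, p \in [pchar K] -> (d < p)%N) :
  exists U : 'M[K]_(n, d) -> Prop,
    [/\ zariski_open_in (@is_toeplitz K n d) U,
        zariski_dense_in (@is_toeplitz K n d) U
      & forall V : 'M[K]_(n, d), U V -> forall y : 'cV[K]_n,
          at_most d`! (system_root iota V y)].
Proof.
have red0 D : all_reducible (pid_mx d : 'M[K]_(n, d)) D.
  move=> g gD; have [c cD [G Gle gE]] := reducible_power_sums K_char gD.
  exists c => //; exists G => //; rewrite gE; apply: eq_bigr => l _.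
  by rewrite /pullbacks pullback_pid.
have [f f0 fred] := all_reducible_upto_open (\sum_(i < d) i).+1 red0.
exists (fun V => is_toeplitz V /\ mx_eval f V != 0); split.
- exists (eq f) => V; split=> [[Vt fV]|[Vt [g <- fV]]]; last by [].
  by split=> //; exists f.
- apply: principal_dense f0 => //; last exact: toeplitz_pid.
  by move=> A B t; apply: toeplitz_affine.
- by move=> V [_ fV] y; apply: at_most_roots; apply: fred.
Qed.
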